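(* For all integers $n\ge 1$ and $1\le r\le n$, there exists a deterministic online algorithm for $r$-uniform Online Min-Sum Set Cover on a universe of $n$ elements that is $(5r+2)$-competitive against the static optimum.
   Context: Let $U$ be a set of $n$ elements. A permutation $\pi$ of $U$ assigns each element $e$ a position $\pi[e]\in\{1,\dots,n\}$. For nonempty $S\subseteq U$, the access cost is $\pi(S)=\min_{e\in S}\pi[e]$. The Kendall tau distance $d_{KT}(\pi,\sigma)$ is the number of unordered pairs of elements ordered differently by $\pi$ and $\sigma$. In $r$-uniform Online Min-Sum Set Cover, an initial permutation $\pi_0$ is given and request sets $S_1,\dots,S_m\subseteq U$ with $|S_t|=r$ arrive one by one. When $S_t$ arrives, the algorithm, holding $\pi_{t-1}$, pays access cost $\pi_{t-1}(S_t)$ and then chooses $\pi_t$ (depending only on $\pi_0,S_1,\dots,S_t$), paying moving cost $d_{KT}(\pi_{t-1},\pi_t)$. The algorithm's cost is total access plus moving cost. The static optimum is $\mathrm{OPT}=\min_{\pi}\sum_{t=1}^m\pi(S_t)$. An online algorithm is $c$-competitive if there is a constant $\alpha$ (independent of the request sequence, possibly depending on $n,r$) such that its cost is at most $c\cdot\mathrm{OPT}+\alpha$ for every initial permutation and request sequence. *)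

(* Defs.v *)
From mathcomp Require Import all_boot.

Set Implicit Arguments.
Unset Strict Implicit.
Unset Printing Implicit Defensive.

(* An injective map from U to 'I_#|U| is a bijection, so these are exactly the
   permutations of U, seen as assignments of positions to elements. *)
Definition permutation (U : finType) : Type :=
  {p : {ffun U -> 'I_#|U|} | injectiveb p}.

(* 'I_#|U| starts at 0 whereas positions start at 1. *)
Definition pos (U : finType) (p : permutation U) (e : U) : nat := (val p e).+1.

(* The neutral value #|U| is the largest position, so for S != set0 this is the
   minimum of pos p over S; the value at set0 is irrelevant. *)
Definition access_cost (U : finType) (p : permutation U) (S : {set U}) : nat :=
  \big[minn/#|U|]_(e in S) pos p e.

(* Each unordered pair ordered differently by p and q is counted once, as the
   pair (x, y) such that p puts x before y. *)
Definition kendall_tau (U : finType) (p q : permutation U) : nat :=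
  #|[set xy : U * U | (pos p xy.1 < pos p xy.2) && (pos q xy.2 < pos q xy.1)]|.

Definition static_cost (U : finType) (p : permutation U)
    (s : seq {set U}) : nat :=
  \sum_(S <- s) access_cost p S.

Lemma enum_rank_injectiveb (U : finType) :
  injectiveb [ffun e : U => enum_rank e].
Proof. by apply/injectiveP => x y; rewrite !ffunE; apply: enum_rank_inj. Qed.

(* Witnesses that permutation U is inhabited, as required by [arg min]. *)
Definition enum_permutation (U : finType) : permutation U :=
  exist _ [ffun e : U => enum_rank e] (enum_rank_injectiveb U).

Definition static_opt (U : finType) (s : seq {set U}) : nat :=
  static_cost [arg min_(p < enum_permutation U) static_cost p s] s.

(* A p0 [:: S_1; ...; S_t] is the permutation chosen after the arrival of S_t,
   for t >= 1; the value of A p0 on the empty sequence is never used. *)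
Definition online_algorithm (U : finType) : Type :=
  permutation U -> seq {set U} -> permutation U.

Definition held (U : finType) (A : online_algorithm U) (p0 : permutation U)
    (s : seq {set U}) : permutation U :=
  if s is [::] then p0 else A p0 s.

(* The index t counts from 0: nth set0 s t is the request S_(t+1), and
   held A p0 (take t s) is the permutation held when it arrives. *)
Definition online_cost (U : finType) (A : online_algorithm U)
    (p0 : permutation U) (s : seq {set U}) : nat :=
  \sum_(t < size s)
     (access_cost (held A p0 (take t s)) (nth set0 s t)
      + kendall_tau (held A p0 (take t s)) (held A p0 (take t.+1 s))).

Definition uniform_requests (U : finType) (r : nat) (s : seq {set U}) : bool :=
  all (fun S : {set U} => #|S| == r) s.

(* All costs are natural numbers, so a natural additive constant loses no
   generality over a real one. *)
Definition competitive (U : finType) (r c : nat) (A : online_algorithm U)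
    : Prop :=
  exists alpha : nat,
    forall (p0 : permutation U) (s : seq {set U}),
      uniform_requests r s ->
      online_cost A p0 s <= c * static_opt s + alpha.

(* Main.v *)
(* Group the requests into phases of n^2 and run multiplicative weights over all
   permutations p of U, weighting p by (1 - eta) ^ (4 r * cost of p so far) with
   eta tiny.  During a phase hold one permutation obtained by rounding the
   weights: greedily split U into blocks of r elements, each block being an r-set
   of least weighted access cost among the elements left.  If S first meets the
   block of index i, then S was available for all blocks 0, ..., i; these are
   disjoint, so every permutation accesses them at i+1 distinct positions, and
   the weighted access cost of S is at least (i+1)/2, whereas the rounded
   permutation accesses S at position at most (i+1) r.  Rounding thus loses a
   factor 2r.  The loss 4r, instead of 2r, of the potential argument leaves room
   for crude linear estimates of powers.  Moving costs at most n^2 per phase,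
   hence at most 1 per request, which OPT pays anyway: the ratio is 4r + 1. *)
Require Import Defs.
From mathcomp Require Import all_boot.
From mathcomp Require Import all_order all_algebra zify ring lra.

Set Implicit Arguments.
Unset Strict Implicit.
Unset Printing Implicit Defensive.

Import Order.TTheory GRing.Theory Num.Theory.

(** * Access costs of disjoint sets; permutations built from rankings *)

Lemma pos_inj (U : finType) (p : permutation U) : injective (pos p).
Proof.
move=> x y /succn_inj /val_inj.
by have /injectiveP := valP p; apply.
Qed.

Lemma access_cost_le (U : finType) (p : permutation U) (S : {set U}) e :
  e \in S -> access_cost p S <= pos p e.
Proof. by move=> eS; rewrite /access_cost -minEnat -leEnat; exact: bigmin_le_cond. Qed.

Lemma access_cost_attained (U : finType) (p : permutation U) (S : {set U}) :
  S != set0 -> exists2 e, e \in S & access_cost p S = pos p e.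
Proof.
case/set0Pn=> e0 e0S; rewrite /access_cost -minEnat.
have posU i : i \in S -> (pos p i <= #|U|)%O by move=> _; exact: ltn_ord.
have [e eS E] := eq_bigmin e0 _ _ e0S posU.
by exists e.
Qed.

Lemma access_cost_gt0 (U : finType) (p : permutation U) (S : {set U}) :
  S != set0 -> 0 < access_cost p S.
Proof. by case/(access_cost_attained p) => e _ ->. Qed.

Lemma access_cost_le_card (U : finType) (p : permutation U) (S : {set U}) :
  access_cost p S <= #|U|.
Proof. by rewrite /access_cost -minEnat -leEnat; exact: bigmin_le_id. Qed.

(** Once sorted, distinct positive numbers have a j-th entry of at least j. *)
Lemma uniq_sum_ge (s : seq nat) :
  uniq s -> 0 \notin s -> size s * size s <= 2 * \sum_(x <- s) x.
Proof.
(* A path from [m] records the lower bound that each tail inherits from its head, which the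
   induction needs. *)
have aux m t : path ltn m t ->
    size t * (size t + 2 * m) <= 2 * \sum_(x <- t) x.
  elim: t m => [|x t IHt] m /=; first by rewrite big_nil.
  by case/andP=> lt_mx /IHt; rewrite big_cons; nia.
move=> s_uniq s_pos; rewrite -(perm_big _ (permEl (perm_sort leq s))) /=.
rewrite -(size_sort leq) -[size (sort _ _) in X in _ * X]addn0.
apply: (aux 0); rewrite path_min_sorted.
  by rewrite ltn_sorted_uniq_leq sort_uniq s_uniq sort_sorted //; exact: leq_total.
by apply/allP=> x; rewrite mem_sort /= lt0n; apply: contraTneq => ->.
Qed.

(** Disjoint nonempty sets attain their access costs at different elements, so these costs are
    distinct positive numbers. *)
Lemma sum_access_disjoint (U : finType) (p : permutation U)
    (T : nat -> {set U}) k :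
  (forall j, j < k -> T j != set0) ->
  (forall i j, i < j < k -> [disjoint T i & T j]) ->
  k * k <= 2 * \sum_(j < k) access_cost p (T j).
Proof.
move=> T0 Tdis.
have := @uniq_sum_ge [seq access_cost p (T j) | j <- iota 0 k].
rewrite size_map size_iota big_map.
rewrite -(big_mkord xpredT (fun j => access_cost p (T j))) /index_iota subn0.
apply.
- rewrite map_inj_in_uniq ?iota_uniq // => i j.
  have neq a b : a < b < k -> access_cost p (T a) <> access_cost p (T b).
    move=> /andP[ab bk] E.
    have [x xa Ea] := access_cost_attained p (T0 _ (ltn_trans ab bk)).
    have [y yb Eb] := access_cost_attained p (T0 _ bk).
    have /pos_inj xy : pos p x = pos p y by rewrite -Ea -Eb.
    have abk : a < b < k by rewrite ab.
    by have := disjointFr (Tdis a b abk) xa; rewrite xy yb.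
  rewrite !mem_iota /= !add0n => ik jk E.
  by case: (ltngtP i j) => // ij; [case: (neq i j)|case: (neq j i)];
    rewrite ?ij.
- apply/mapP => -[j]; rewrite mem_iota /= add0n => /T0/(access_cost_gt0 p).
  by case: access_cost.
Qed.

(** Sort [U] by [b]: everything placed up to [e] has rank at most [b e]. *)
Lemma permutation_of_ranking (U : finType) (b : U -> nat) :
  exists p : permutation U, forall e, pos p e <= #|[set x | b x <= b e]|.
Proof.
pose le_b x y := b x <= b y.
have le_b_tr : transitive le_b by move=> y x z; exact: leq_trans.
have le_b_refl : reflexive le_b by move=> x; exact: leqnn.
have le_b_tot : total le_b by move=> x y; exact: leq_total.
pose s := sort le_b (enum U).
have s_uniq : uniq s by rewrite sort_uniq enum_uniq.
have in_s x : x \in s by rewrite mem_sort mem_enum.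
have lt_index x : index x s < #|U|.
  by rewrite cardE -(size_sort le_b) index_mem.
have f_inj : injectiveb [ffun x => Ordinal (lt_index x)].
  apply/injectiveP=> x y; rewrite !ffunE => /(congr1 val) /= E.
  by rewrite -(nth_index x (in_s x)) E nth_index.
exists (exist (fun f : {ffun U -> _} => injectiveb f) _ f_inj) => e.
rewrite /pos /= ffunE /=.
have ltS : (index e s).+1 <= size s by rewrite index_mem.
rewrite -[X in X <= _](size_takel ltS) -(card_uniqP (take_uniq _ s_uniq)).
apply/subset_leq_card/subsetP => x.
case/(nthP e) => i; rewrite size_takel // => ie <-; rewrite nth_take // inE.
have := @sorted_leq_nth _ le_b le_b_tr le_b_refl e s (sort_sorted le_b_tot _).
move=> /(_ i (index e s)); rewrite nth_index // !inE; apply => //.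
exact: leq_trans ie ltS.
Qed.

Local Open Scope ring_scope.

(** * Rounding weights on permutations by greedy blocks *)

Section Rounding.

Variables (R : realFieldType) (U : finType) (r : nat).
Variable w : permutation U -> R.
Hypotheses (w_ge0 : forall p, 0 <= w p) (r_gt0 : (0 < r)%N).

Definition weighted_cost (S : {set U}) : R :=
  \sum_p w p * (access_cost p S)%:R.

Definition eligible (C : {set U}) : pred {set U} :=
  fun S => (#|S| == r) && [disjoint S & C].

(** The value [set0] arises once fewer than [r] elements lie outside [C]; the cover then stops
    growing. *)
Definition cheapest (C : {set U}) : {set U} :=
  if [pick S | eligible C S] is Some S0
  then [arg min_(S < S0 | eligible C S) weighted_cost S]%O else set0.

Definition covered (i : nat) : {set U} :=
  iter i (fun C => C :|: cheapest C) set0.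

Lemma cheapestP C S : eligible C S ->
  eligible C (cheapest C) /\ weighted_cost (cheapest C) <= weighted_cost S.
Proof.
rewrite /cheapest => elS.
case: pickP => [S0 el0|/(_ S)]; last by rewrite elS.
by case: arg_minP => // T elT Tmin; split=> //; apply: Tmin.
Qed.

Lemma card_cheapest C : (#|cheapest C| <= r)%N.
Proof.
rewrite /cheapest; case: pickP => [S0 el0|_]; last by rewrite cards0.
by case: arg_minP => // T /andP[/eqP->].
Qed.

Lemma card_covered i : (#|covered i| <= i * r)%N.
Proof.
elim: i => [|i IHi]; first by rewrite cards0.
rewrite mulSn addnC; apply: leq_trans (leq_card_setU _ _) _.
exact: leq_add (card_cheapest _).
Qed.

Lemma covered_mono i j : (i <= j)%N -> covered i \subset covered j.
Proof.
elim: j => [|j IHj]; first by rewrite leqn0 => /eqP->.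
rewrite leq_eqVlt => /predU1P[->//|/IHj]; move/subset_trans; apply.
exact: subsetUl.
Qed.

Lemma cheapest_covered i j : (i < j)%N -> cheapest (covered i) \subset covered j.
Proof. by move=> /covered_mono; apply: subset_trans; exact: subsetUr. Qed.

(** [S] was eligible when each of the blocks 0 to [i] was chosen, so it costs at least their
    average, and these blocks are disjoint. *)
Lemma weighted_cost_ge (S : {set U}) i : #|S| = r -> [disjoint S & covered i] ->
  (\sum_p w p) * i.+1%:R <= 2%:R * weighted_cost S.
Proof.
move=> Sr Sdis.
have elS j : (j < i.+1)%N -> eligible (covered j) S.
  rewrite ltnS => ji; rewrite /eligible Sr eqxx /=.
  exact: disjointWr (covered_mono ji) Sdis.
(* Both sides are multiplied by [i.+1] to compare them with the sum over all [i.+1] blocks instead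
   of the average. *)
have scaled : (i.+1%:R * \sum_p w p) * i.+1%:R <=
    i.+1%:R * (2%:R * weighted_cost S).
  apply: (@le_trans _ _
      (2%:R * \sum_(j < i.+1) weighted_cost (cheapest (covered j)))).
    rewrite /weighted_cost exchange_big /= mulr_sumr mulr_suml mulr_sumr.
    apply: ler_sum => p _; rewrite -mulr_sumr -natr_sum.
    rewrite -mulrA [X in _ <= X]mulrCA [X in X <= _]mulrCA.
    apply: ler_wpM2l => //; rewrite -!natrM ler_nat.
    apply: (sum_access_disjoint p (T := fun j => cheapest (covered j))).
    - move=> j /elS/cheapestP[/andP[/eqP Tr _] _].
      by rewrite -card_gt0 Tr.
    - move=> a b /andP[ab /elS/cheapestP[/andP[_ Tdis] _]].
      rewrite disjoint_sym; exact: disjointWr (cheapest_covered ab) Tdis.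
  rewrite mulrCA ler_pM2l ?ltr0n //.
  rewrite mulr_natl -[in X in _ <= X](card_ord i.+1) -sumr_const.
  by apply: ler_sum => j _; have [] := cheapestP (elS _ (ltn_ord j)).
by move: scaled; rewrite -mulrA ler_pM2l ?ltr0n.
Qed.

Lemma first_cover (S : {set U}) : #|S| = r ->
  exists2 i, (i <= #|U|)%N &
    [disjoint S & covered i] && ~~ [disjoint S & covered i.+1].
Proof.
move=> Sr.
have: ~~ [disjoint S & covered #|U|.+1].
  apply/negP => dis.
  (* As long as [S] is untouched it remains eligible, so every block brings [r], hence at least one,
     new elements; [#|U|.+1] blocks would overflow [U]. *)
  have full j : (j <= #|U|.+1)%N -> (j <= #|covered j|)%N.
    elim: j => // j IHj lt_j.
    have elS : eligible (covered j) S.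
      by rewrite /eligible Sr eqxx (disjointWr (covered_mono (ltnW lt_j)) dis).
    have [/andP[/eqP Tr Tdis] _] := cheapestP elS.
    have -> : #|covered j.+1| = (#|covered j| + r)%N.
      by apply/eqP; rewrite -[in X in _ == X]Tr /= (leq_card_setU _ _).2 disjoint_sym.
    have := IHj (ltnW lt_j); lia.
  by have := leq_trans (full _ (leqnn _)) (max_card _); rewrite ltnn.
elim: {1 3}#|U| (leqnn #|U|) => [|i IHi] lt_i Hi.
  exists 0%N => //; rewrite Hi andbT -setI_eq0 setI0 eqxx //.
have [dis|ndis] := boolP [disjoint S & covered i.+1].
  by exists i.+1 => //; rewrite dis.
exact: IHi (ltnW lt_i) ndis.
Qed.

Lemma rounding : exists q : permutation U, forall S : {set U}, #|S| = r ->
  (\sum_p w p) * (access_cost q S)%:R <= (2 * r)%:R * weighted_cost S.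
Proof.
(* [b x] is the index of the block containing [x]; elements in no block get the default [#|U|.+1] of
   [find] and are ranked last. *)
pose b x := find (fun j => x \in covered j.+1) (iota 0 #|U|.+1).
have [q Hq] := permutation_of_ranking b.
exists q => S Sr; have [i le_i /andP[Sdis]] := first_cover Sr.
case/pred0Pn => e /andP[/= eS ei].
have le_b : (b e <= i)%N.
  rewrite leqNgt; apply/negP => /(before_find 0%N).
  by rewrite nth_iota ?ltnS // add0n ei.
have sub_b : [set x | (b x <= b e)%N] \subset covered i.+1.
  apply/subsetP => x; rewrite inE => /leq_trans/(_ le_b) le_x.
  apply: (subsetP (covered_mono (le_x : b x < i.+1)%N)).
  have has_x : has (fun j => x \in covered j.+1) (iota 0 #|U|.+1).
    by rewrite has_find size_iota ltnS; exact: leq_trans le_x le_i.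
  have := nth_find 0%N has_x; rewrite -/(b x) nth_iota ?add0n //.
  exact: leq_trans le_x le_i.
have le_q : (access_cost q S <= i.+1 * r)%N.
  apply: leq_trans (access_cost_le q eS) _; apply: leq_trans (Hq e) _.
  exact: leq_trans (subset_leq_card sub_b) (card_covered _).
have W_ge0 : 0 <= \sum_p w p by apply: sumr_ge0.
apply: (@le_trans _ _ ((\sum_p w p) * i.+1%:R * r%:R)).
  by rewrite -mulrA -natrM; apply: ler_wpM2l => //; rewrite ler_nat.
rewrite natrM [2%:R * _ * _]mulrAC; apply: ler_wpM2r => //.
exact: weighted_cost_ge.
Qed.

End Rounding.

(** * Linear bounds on powers of [1 - eta] *)

Lemma pow_one_sub_le (R : realFieldType) (eta : R) k :
  0 <= eta -> k%:R * eta <= 1 -> (1 - eta) ^+ k <= 1 - k%:R * eta / 2%:R.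
Proof.
(* The halved slope absorbs the quadratic term: [k * eta ^ 2 / 2] is at most [eta / 2]. *)
move=> eta0; elim: k => [|k IHk]; first by rewrite expr0; lra.
rewrite exprS -natr1 => kle1.
have k0 : 0 <= k%:R :> R by [].
have := IHk ltac:(lra); set x := (1 - eta) ^+ k => Hx.
have : 0 <= k%:R * eta * (1 - k%:R * eta) by apply: mulr_ge0; nra.
have : (1 - eta) * x <= (1 - eta) * (1 - k%:R * eta / 2%:R).
  by apply: ler_wpM2l => //; nra.
nra.
Qed.

Lemma pow_one_sub_ge (R : realFieldType) (eta : R) k :
  0 <= eta <= 1 -> 1 - k%:R * eta <= (1 - eta) ^+ k.
Proof.
move=> /andP[eta0 eta1]; elim: k => [|k IHk]; first by rewrite expr0; lra.
rewrite exprS -natr1.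
have k0 : 0 <= k%:R :> R by [].
have : (1 - eta) * (1 - k%:R * eta) <= (1 - eta) * (1 - eta) ^+ k.
  by apply: ler_wpM2l => //; lra.
have : 0 <= k%:R * (eta * eta) by rewrite !mulr_ge0.
nra.
Qed.

(** With [A = D * N], the power is at most [2 ^ - N], and [N < 2 ^ N]. *)
Lemma exists_small_power (R : realFieldType) (D N : nat) : (0 < D)%N ->
  exists A : nat, N%:R * (1 - D%:R^-1) ^+ A < 1 :> R.
Proof.
move=> D0; exists (D * N)%N; rewrite exprM.
have D0R : 0 < D%:R :> R by rewrite ltr0n.
have half : (1 - D%:R^-1) ^+ D <= 2%:R^-1 :> R.
  have := @pow_one_sub_le R D%:R^-1 D.
  rewrite mulfV ?gt_eqF // invr_ge0 ltW // => /(_ isT (lexx _)); lra.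
have D1 : 0 <= 1 - D%:R^-1 :> R.
  by rewrite subr_ge0 invf_le1 // ler1n.
apply: (@le_lt_trans _ _ (N%:R * 2%:R^-1 ^+ N)).
  by apply: ler_wpM2l => //; rewrite lerXn2r ?nnegrE ?exprn_ge0 ?invr_ge0.
rewrite exprVn -natrX ltr_pdivrMr ?ltr0n ?expn_gt0 // mul1r ltr_nat.
exact: ltn_expl.
Qed.

(** * Crude bounds on static costs and Kendall tau distances *)

Lemma static_cost_cat (U : finType) (p : permutation U) s1 s2 :
  static_cost p (s1 ++ s2) = (static_cost p s1 + static_cost p s2)%N.
Proof. exact: big_cat. Qed.

Lemma static_cost_le (U : finType) (p : permutation U) s :
  (static_cost p s <= size s * #|U|)%N.
Proof.
elim: s => [|S s IHs]; rewrite /static_cost ?big_nil // big_cons mulSn.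
exact: leq_add (access_cost_le_card _ _) IHs.
Qed.

Lemma size_le_static_cost (U : finType) r (p : permutation U) s :
  (0 < r)%N -> uniform_requests r s -> (size s <= static_cost p s)%N.
Proof.
move=> r0; elim: s => //= S s IHs /andP[/eqP Sr /IHs].
rewrite /static_cost big_cons -add1n; apply: leq_add.
by rewrite access_cost_gt0 // -card_gt0 Sr.
Qed.

Lemma static_opt_attained (U : finType) (s : seq {set U}) :
  exists p : permutation U, static_opt s = static_cost p s.
Proof. by rewrite /static_opt; eexists. Qed.

Lemma kendall_tauxx (U : finType) (p : permutation U) : kendall_tau p p = 0%N.
Proof. by apply: eq_card0 => xy; rewrite inE; case: ltngtP. Qed.

Lemma kendall_tau_le (U : finType) (p q : permutation U) :
  (kendall_tau p q <= #|U| * #|U|)%N.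
Proof. by rewrite -card_prod; exact: max_card. Qed.

(** * Decay of the potential over phases *)

Section Phases.

Variables (R : realFieldType) (U : finType) (r K : nat) (eta : R).
Variable rho : seq {set U} -> permutation U.

(** The total weight in the multiplicative weights method. *)
Definition potential (s : seq {set U}) : R :=
  \sum_(p : permutation U) (1 - eta) ^+ (4 * r * static_cost p s).

Hypothesis eta_ge0 : 0 <= eta.
Hypothesis eta_small : (4 * r * (K * #|U|))%:R * eta <= 1.
Hypothesis eta_lt1 : eta < 1.
Hypothesis rhoP : forall s (S : {set U}), #|S| = r ->
  potential s * (access_cost (rho s) S)%:R <=
  (2 * r)%:R *
    weighted_cost (fun p => (1 - eta) ^+ (4 * r * static_cost p s)) S.

Lemma theta_ge0 : 0 <= 1 - eta.
Proof. by rewrite subr_ge0 ltW. Qed.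

(** Each weight shrinks by at least [2 * r * eta] times its cost in the phase, to first order.
    Rounding bounds the weighted mean of these costs below by the cost of [rho s1] over [2 * r], and
    Bernoulli's inequality turns the resulting linear factor into a power. *)
Lemma potential_phase s1 s2 :
  (size s2 <= K)%N -> uniform_requests r s2 ->
  potential (s1 ++ s2) <=
    potential s1 * (1 - eta) ^+ static_cost (rho s1) s2.
Proof.
move=> s2K s2r.
pose w p := (1 - eta) ^+ (4 * r * static_cost p s1).
have w0 p : 0 <= w p by apply: exprn_ge0; exact: theta_ge0.
have H1 : potential s1 * (static_cost (rho s1) s2)%:R <=
    (2 * r)%:R * \sum_p w p * (static_cost p s2)%:R.
  have -> : \sum_p w p * (static_cost p s2)%:R = \sum_(S <- s2) weighted_cost w S.
    rewrite /static_cost; under eq_bigr do rewrite natr_sum mulr_sumr.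
    exact: exchange_big.
  rewrite /static_cost natr_sum !mulr_sumr.
  rewrite [X in X <= _]big_seq [X in _ <= X]big_seq; apply: ler_sum => S Ss2.
  by apply: rhoP; apply/eqP; exact: (allP s2r).
have H2 : potential (s1 ++ s2) <=
    \sum_p w p * (1 - eta * ((2 * r)%:R * (static_cost p s2)%:R)).
  apply: ler_sum => p _; rewrite static_cost_cat mulnDr exprD.
  apply: ler_wpM2l; first exact: w0.
  have := @pow_one_sub_le _ eta (4 * r * static_cost p s2) eta_ge0.
  (* A phase costs any permutation at most [K * #|U|], which keeps the exponent in the range of the
     linear bound. *)
  have small : (4 * r * static_cost p s2)%:R * eta <= 1.
    apply: le_trans eta_small; apply: ler_wpM2r => //; rewrite ler_nat.
    rewrite leq_mul2l; apply/orP; right.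
    apply: leq_trans (static_cost_le _ _) _.
    by rewrite leq_mul2r s2K orbT.
  move/(_ small) => /le_trans; apply; rewrite !natrM; lra.
have H3 : \sum_p w p * (1 - eta * ((2 * r)%:R * (static_cost p s2)%:R)) =
    potential s1 - eta * ((2 * r)%:R * \sum_p w p * (static_cost p s2)%:R).
  rewrite /potential !mulr_sumr -sumrB; apply: eq_bigr => p _.
  by rewrite -/(w p); ring.
apply: le_trans H2 _; rewrite {}H3.
have pot0 : 0 <= potential s1 by apply: sumr_ge0 => p _; exact: w0.
apply: (@le_trans _ _
    (potential s1 * (1 - (static_cost (rho s1) s2)%:R * eta))).
  by have := ler_wpM2l eta_ge0 H1; lra.
by apply: ler_wpM2l => //; rewrite pow_one_sub_ge // eta_ge0 ltW.
Qed.

Definition phase_start (t : nat) : nat := t %/ K * K.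

Hypothesis K_gt0 : (0 < K)%N.

Lemma potential_le s t :
  uniform_requests r s -> (t <= size s)%N ->
  potential (take t s) <= #|{: permutation U}|%:R *
    (1 - eta) ^+
      (\sum_(0 <= u < t)
        access_cost (rho (take (phase_start u) s)) (nth set0 s u)).
Proof.
move=> sr; elim/ltn_ind: t => -[|t] IHt lt_ts.
  rewrite take0 big_geq // expr0 mulr1 /potential.
  under eq_bigr do rewrite /static_cost big_nil muln0 expr0.
  by rewrite sumr_const.
(* The last request, of index [t], lies in the phase starting at [u]: the prefix splits into whole
   phases and one possibly incomplete phase. *)
set u := phase_start t.
have le_ut : (u <= t)%N by exact: leq_divM.
have lt_tu : (t.+1 <= u + K)%N.
  by rewrite /u /phase_start -mulSnr -ltn_divLR.
have sz2 : size (drop u (take t.+1 s)) = (t.+1 - u)%N.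
  by rewrite size_drop size_takel.
have s2r : uniform_requests r (drop u (take t.+1 s)).
  apply/allP => S /mem_drop/mem_take; exact: (allP sr).
have -> : take t.+1 s = take u s ++ drop u (take t.+1 s).
  by rewrite -{1}[take t.+1 s](cat_take_drop u) take_takel // ltnW.
apply: le_trans (potential_phase _ _ s2r) _; first by rewrite sz2; lia.
have le_us : (u <= size s)%N by lia.
have := IHt u le_ut le_us.
rewrite (@big_cat_nat _ _ _ u 0 t.+1) //=; last by lia.
rewrite exprD mulrA.
have -> : (\sum_(u <= i < t.+1)
    access_cost (rho (take (phase_start i) s)) (nth set0 s i) =
    static_cost (rho (take u s)) (drop u (take t.+1 s)))%N.
  rewrite /static_cost (big_nth set0) sz2 -{1}[u]add0n big_addn.
  rewrite !big_nat; apply: eq_bigr => i lt_i.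
  rewrite nth_drop nth_take; last by lia.
  have -> : phase_start (i + u) = u.
    have le_it : (i + u <= t)%N by lia.
    have := leq_div2r K le_it; have := leq_div2r K (leq_addl i u).
    by rewrite /u /phase_start mulnK // => ? ?; congr (_ * K)%N; lia.
  by rewrite addnC.
move=> H; apply: ler_wpM2r => //; apply: exprn_ge0; exact: theta_ge0.
Qed.

End Phases.

(** * The phase algorithm and its cost *)

Section Algorithm.

Variables (U : finType) (K : nat) (rho : seq {set U} -> permutation U).
Hypothesis K_gt0 : (0 < K)%N.

(** The history is cut at the last completed phase, so the value changes only at multiples of
    [K]. *)
Definition phase_algorithm : online_algorithm U :=
  fun _ s => rho (take (phase_start K (size s)) s).

Lemma held_phase_algorithm p0 s t : (0 < t <= size s)%N ->
  held phase_algorithm p0 (take t s) = rho (take (phase_start K t) s).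
Proof.
move=> /andP[t0 ts].
have -> : held phase_algorithm p0 (take t s) = phase_algorithm p0 (take t s).
  by move: (take t s) (size_takel ts) => [|//] /esym t_eq0; rewrite t_eq0 in t0.
by rewrite /phase_algorithm size_takel // take_takel // leq_divM.
Qed.

Lemma online_cost_phase_algorithm p0 s :
  (online_cost phase_algorithm p0 s <=
    \sum_(0 <= u < size s)
      access_cost (rho (take (phase_start K u) s)) (nth set0 s u)
    + size s %/ K * (#|U| * #|U|) + (#|U| + #|U| * #|U|))%N.
Proof.
rewrite /online_cost -(big_mkord xpredT (fun u =>
  access_cost (held phase_algorithm p0 (take u s)) (nth set0 s u)
  + kendall_tau (held phase_algorithm p0 (take u s))
      (held phase_algorithm p0 (take u.+1 s)))%N).
elim: {-2}(size s) (leqnn (size s)) => [|t IHt] lt_ts.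
  by rewrite !big_geq.
rewrite !big_nat_recr //= divnS // (@held_phase_algorithm p0 s t.+1) //.
move: {IHt}(IHt (ltnW lt_ts)).
(* [p0] is held for the first request only; that access and the move away from [p0] make up the
   additive constant. *)
case: t lt_ts => [|t] lt_ts IH.
  rewrite big_geq // add0n; apply: leq_trans (leq_addl _ _).
  exact: leq_add (access_cost_le_card _ _) (kendall_tau_le _ _).
have lt_t : (0 < t.+1 <= size s)%N by exact: ltnW.
rewrite (held_phase_algorithm p0 lt_t).
have step X Y d m c a k b : (X <= Y + d * m + c -> k <= b * m ->
    X + (a + k) <= Y + a + (b + d) * m + c)%N by clear; rewrite mulnDl; lia.
(* If [K] divides [t.+2], the quotient grows by one and pays for the move; otherwise the permutation
   stays the same. *)
apply: step IH _; rewrite [phase_start K t.+2]/phase_start divnS // mulnDl.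
case: (K %| t.+2)%N => /=; first by rewrite !mul1n kendall_tau_le.
by rewrite !mul0n add0n kendall_tauxx.
Qed.

End Algorithm.

(** * Regret bound and choice of parameters *)

Lemma access_regret (R : realFieldType) (U : finType) (r K D : nat)
    (rho : seq {set U} -> permutation U) :
  (0 < K)%N -> (1 < D)%N -> (4 * r * (K * #|U|) <= D)%N ->
  (forall s (S : {set U}), #|S| = r ->
    potential r (D%:R^-1 : R) s * (access_cost (rho s) S)%:R <=
    (2 * r)%:R *
      weighted_cost (fun p => (1 - D%:R^-1 : R) ^+ (4 * r * static_cost p s)) S) ->
  exists A : nat, forall s, uniform_requests r s ->
    (\sum_(0 <= u < size s)
      access_cost (rho (take (phase_start K u) s)) (nth set0 s u) <=
    4 * r * static_opt s + A)%N.
Proof.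
move=> K0 D1 leD rhoP.
have D0 : (0 < D)%N by exact: ltnW.
(* [A] is chosen so that [A] extra units of cost outweigh the initial potential, the number of
   permutations. *)
have [A HA] := exists_small_power R #|{: permutation U}| D0.
exists A => s sr; rewrite leqNgt; apply/negP => lt_sum.
set eta : R := D%:R^-1 in rhoP HA.
have eta0 : 0 <= eta by rewrite invr_ge0.
have eta1 : eta < 1 by rewrite invf_lt1 ?ltr1n ?ltr0n.
have theta0 : 0 < 1 - eta by rewrite subr_gt0.
have eta_small : (4 * r * (K * #|U|))%:R * eta <= 1.
  by rewrite ler_pdivrMr ?ltr0n // mul1r ler_nat.
have := potential_le eta0 eta_small eta1 rhoP K0 sr (leqnn (size s)).
rewrite take_size; apply/negP; rewrite -ltNge.
have [p Hp] := static_opt_attained s.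
(* The middle term is the weight of an optimal permutation, a single summand of the potential. *)
apply: (@lt_le_trans _ _ ((1 - eta) ^+ (4 * r * static_opt s))).
  apply: (@le_lt_trans _ _
      (#|{: permutation U}|%:R * (1 - eta) ^+ (4 * r * static_opt s + A))).
    apply: ler_wpM2l => //; apply: ler_wiXn2l (ltnW lt_sum); lra.
  by rewrite exprD mulrCA gtr_pMr // exprn_gt0.
rewrite /potential (bigD1 p) //= -Hp lerDl; apply: sumr_ge0 => q _.
by rewrite exprn_ge0 // ltW.
Qed.

Local Close Scope ring_scope.

Theorem theorem2 (n r : nat) (U : finType) (hn : 1 <= n) (hr : 1 <= r <= n)
    (hU : #|U| = n) :
  exists A : online_algorithm U, competitive r (5 * r + 2) A.
Proof.
case/andP: hr => r0 _.
(* A phase of [n * n] requests makes one move cost at most 1 per request; with [eta = 1 / D] a whole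
   phase stays in the linear range. *)
pose K := (n * n)%N; pose D := (4 * r * (K * n))%N.
have K0 : (0 < K)%N by rewrite muln_gt0 hn.
have D1 : (1 < D)%N by rewrite /D; nia.
pose w (s : seq {set U}) p : rat :=
  ((1 - D%:R^-1) ^+ (4 * r * static_cost p s))%R.
have w0 s p : (0 <= w s p)%R.
  by rewrite exprn_ge0 // subr_ge0 invf_le1 ?ler1n ?ltr0n // ltnW.
(* A boolean property lets [xchoose] turn existence of a rounding into a function of the past
   requests, hence a deterministic algorithm. *)
pose good s (q : permutation U) := [forall S : {set U}, (#|S| == r) ==>
  ((\sum_p w s p) * (access_cost q S)%:R <= (2 * r)%:R * weighted_cost (w s) S)%R].
have good_ex s : exists q, good s q.
  have [q Hq] := rounding (w0 s) r0.
  by exists q; apply/forallP => S; apply/implyP => /eqP; exact: Hq.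
pose rho s := xchoose (good_ex s).
have rhoP s (S : {set U}) : #|S| = r ->
    ((\sum_p w s p) * (access_cost (rho s) S)%:R <=
     (2 * r)%:R * weighted_cost (w s) S)%R.
  by move/eqP => Sr; have /forallP/(_ S)/implyP := xchooseP (good_ex s); apply.
have leD : (4 * r * (K * #|U|) <= D)%N by rewrite hU.
have [A HA] := access_regret K0 D1 leD rhoP.
exists (phase_algorithm K rho), (A + (n + n * n))%N => p0 s sr.
apply: leq_trans (online_cost_phase_algorithm rho K0 p0 s) _.
have := HA s sr; have [p Hp] := static_opt_attained s.
(* Each request costs the optimum at least 1, so the moves charged to phases add at most OPT: the
   ratio [4 * r + 1] is below [5 * r + 2]. *)
have := size_le_static_cost p r0 sr; rewrite -Hp hU -/K.
have := leq_divM (size s) K.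
nia.
Qed.
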